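(* Let $\mathcal{C}$ be a class of graphs with bounded expansion and let $r$ be a positive integer. Then the class $\mathcal{D}=\{G^r : G\in \mathcal{C}\}$ has the rainbow property; that is, for every positive integer $n$ there exists an integer $N$ such that for every $G\in\mathcal{C}$, every family of $N$ independent sets of size $n$ in $G^r$ contains a rainbow independent set of size $n$.
   Context: All graphs are finite, simple and undirected. The $r$-power $G^r$ of a graph $G$ is the graph on $V(G)$ in which two distinct vertices are adjacent iff their distance in $G$ is at most $r$. Given a family $\mathcal{I}$ of independent sets in a graph, a rainbow independent set is an independent set $I$ for which there is an injection $\phi\colon I\to\mathcal{I}$ with $v\in\phi(v)$ for every $v\in I$. For a graph $H$ and positive integer $n$, $f_H(n)$ is the minimum $k$ such that every family of $k$ independent sets of size $n$ in $H$ contains a rainbow independent set of size $n$; for a class $\mathcal{C}$, $f_{\mathcal{C}}(n)=\sup\{f_H(n): H\in\mathcal{C}\}$, and $\mathcal{C}$ has the rainbow property if $f_{\mathcal{C}}(n)<\infty$ for every positive integer $n$. A $t$-shallow minor of $G$ is a graph obtained from $G$ by contracting a collection of vertex-disjoint (connected) subgraphs each of radius at most $t$ and deleting the remaining vertices. A class $\mathcal{C}$ has bounded expansion if there is a function $f\colon\mathbb{N}\to\mathbb{N}$ such that for every $t$, every $t$-shallow minor of a graph in $\mathcal{C}$ has ratio of edges to vertices at most $f(t)$. *)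

(* Defs.v *)
From mathcomp Require Import all_boot.

Set Implicit Arguments.
Unset Strict Implicit.
Unset Printing Implicit Defensive.

Record sgraph := SGraph {
  vertex :> finType;
  adj : rel vertex;
  adj_sym : symmetric adj;
  adj_irrefl : irreflexive adj }.

Definition graph_class := sgraph -> Prop.

(* The distance from [x] to [y] in the graph with edge relation [e] is at most
   [k], i.e. some walk from [x] to [y] has length at most [k]; this is false
   for every [k] when [x] and [y] are in different components. *)
Definition dist_le (V : finType) (e : rel V) (k : nat) : rel V :=
  [rel x y | [exists m : 'I_k.+1, exists p : m.-tuple V,
                path e x p && (last x p == y)]].

Section Power.
Variables (G : sgraph) (r : nat).

Definition power_adj : rel G :=
  [rel x y | (x != y) && dist_le (@adj G) r x y].

Lemma dist_le_sym : symmetric (dist_le (@adj G) r).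
Proof.
suff sub x y : dist_le (@adj G) r x y -> dist_le (@adj G) r y x.
  by move=> x y; apply/idP/idP; apply: sub.
case/existsP=> m /existsP[p /andP[pth /eqP lst]].
apply/existsP; exists m; apply/existsP.
have szq : size (rev (belast x p)) == m by rewrite size_rev size_belast size_tuple.
exists (Tuple szq); rewrite /= -{1}lst rev_path; apply/andP; split.
  by rewrite (eq_path (e' := @adj G)) // => a b; exact: adj_sym.
by case: (tval p) => [|a s] //= in lst *; rewrite ?lst // rev_cons last_rcons.
Qed.

Lemma power_adj_sym : symmetric power_adj.
Proof. by move=> x y; rewrite /power_adj /= eq_sym dist_le_sym. Qed.

Lemma power_adj_irrefl : irreflexive power_adj.
Proof. by move=> x; rewrite /power_adj /= eqxx. Qed.

Definition power : sgraph := SGraph power_adj_sym power_adj_irrefl.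
End Power.

Definition power_class (r : nat) (C : graph_class) : graph_class :=
  fun H => exists2 G, C G & H = power G r.

Definition independent (G : sgraph) (I : {set G}) : Prop :=
  {in I &, forall x y, ~~ adj x y}.

(* Families are indexed, so the same set may occur several times; [phi] is the
   injection from [I] to (the indices of) the family, and only its values on
   [I] matter. *)
Definition rainbow_independent (G : sgraph) (k : nat) (F : 'I_k -> {set G})
    (I : {set G}) : Prop :=
  independent I /\
  exists phi : G -> 'I_k,
    {in I &, injective phi} /\ {in I, forall v, v \in F (phi v)}.

Definition families_have_rainbow (G : sgraph) (n k : nat) : Prop :=
  forall F : 'I_k -> {set G},
    (forall i, independent (F i) /\ #|F i| = n) ->
    exists2 I : {set G}, rainbow_independent F I & #|I| = n.

(* f_G(n) = k *)
Definition is_rainbow_number (G : sgraph) (n k : nat) : Prop :=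
  families_have_rainbow G n k /\
  forall j, families_have_rainbow G n j -> k <= j.

(* sup {f_H(n) : H in C} is finite for every positive n *)
Definition rainbow_property (C : graph_class) : Prop :=
  forall n, 0 < n -> exists N, forall H, C H ->
    exists2 k, is_rainbow_number H n k & k <= N.

Definition induced_adj (G : sgraph) (B : {set G}) : rel G :=
  [rel x y | [&& x \in B, y \in B & adj x y]].

Definition connected_radius_le (G : sgraph) (t : nat) (B : {set G}) : Prop :=
  exists2 c, c \in B & {in B, forall v, dist_le (induced_adj B) t c v}.

(* [M] is isomorphic to the graph obtained from [G] by contracting the pairwise
   disjoint sets [B u] and deleting the vertices in none of them. Induced
   subgraphs suffice: contracting a subgraph depends only on its vertex set,
   and adding edges to it does not increase its radius. *)
Definition shallow_minor (t : nat) (M G : sgraph) : Prop :=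
  exists B : M -> {set G},
    [/\ forall u, connected_radius_le t (B u),
        forall u v, u != v -> [disjoint B u & B v]
      & forall u v, u != v ->
          (adj u v <-> exists x y, [/\ x \in B u, y \in B v & adj x y])].

Definition edges (G : sgraph) : {set {set G}} :=
  [set [set p.1; p.2] | p in [set p : G * G | adj p.1 p.2]].

Definition bounded_expansion (C : graph_class) : Prop :=
  exists f : nat -> nat, forall t G M,
    C G -> shallow_minor t M G -> #|edges M| <= f t * #|M|.

(* Main.v *)
Require Import Defs.
From mathcomp Require Import all_boot zify.
From Stdlib Require Import Classical.

Set Implicit Arguments.
Unset Strict Implicit.
Unset Printing Implicit Defensive.

(** Bounded expansion classes are uniformly quasi-wide: deleting a bounded set
    [S] makes a large subset of any huge vertex set pairwise far apart. This is
    shown by increasing the radius stepwise, contracting disjoint balls; the edge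
    density of the resulting shallow minors gives independent sets greedily, and
    a vertex reached by too many balls is put into [S], which can happen only a
    bounded number of times because it builds a biclique minor. Given many
    independent sets of [G^r], apply this to their first elements, their second
    elements, and so on, and keep sets whose elements have the same distances
    to [S]. Taking the [k]-th element of the [k]-th chosen set then gives the
    rainbow set: a short walk through [S] between two of its elements would
    yield one inside a single member of the family. *)

(** * Finite combinatorics *)

Lemma card_fiber_bound (T U : finType) (g : T -> U) (D : {set T}) (m : nat) :
  (forall u, #|[set x in D | g x == u]| <= m) -> #|D| <= #|g @: D| * m.
Proof.
move=> fib; rewrite -sum1_card (partition_big_imset g) /= -sum_nat_const.
apply: leq_sum => u _; apply: leq_trans (fib u); rewrite -sum1_card.
by apply: eq_leq; apply: eq_bigl => x; rewrite inE.
Qed.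

Lemma exists_large_fiber (T U : finType) (g : T -> U) (D : {set T}) (m : nat) :
  #|g @: D| * m < #|D| -> exists u, m < #|[set x in D | g x == u]|.
Proof.
move=> lt; apply/existsP; apply: contraLR lt.
rewrite negb_exists -leqNgt => /forallP fib.
by apply: card_fiber_bound => u; rewrite leqNgt.
Qed.

Lemma card_bigcup_le (T : finType) (n : nat) (F : 'I_n -> {set T}) :
  #|\bigcup_(i < n) F i| <= \sum_(i < n) #|F i|.
Proof.
elim/big_ind2: _ => [|x1 x2 y1 y2 h1 h2|//]; rewrite ?cards0 //.
by apply: leq_trans (leq_add h1 h2); rewrite cardsU leq_subr.
Qed.

Section AverageDegree.
Variables (T : finType) (Q : rel T) (d : nat).

(** For symmetric [Q] this is twice the number of edges that [Q] induces on [A], loops ignored. *)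
Definition degree_sum (A : {set T}) : nat :=
  \sum_(a in A) #|[set b in A | (b != a) && Q a b]|.

Lemma exists_low_degree (A : {set T}) :
  A != set0 -> degree_sum A <= d * #|A| ->
  exists2 a, a \in A & #|[set b in A | (b != a) && Q a b]| <= d.
Proof.
move=> A0 le; apply/exists_inP; apply: contraLR le.
rewrite negb_exists -ltnNge => /forallP big.
apply: (@leq_trans (d.+1 * #|A|)).
  by rewrite ltn_mul2r ltnSn andbT lt0n cards_eq0.
rewrite mulnC -sum_nat_const; apply: leq_sum => a aA.
by move: (big a); rewrite aA /= -ltnNge.
Qed.

(** Take an element of degree at most [d] and discard it with its neighbours: each round costs at
    most [d.+1] elements. Sparsity is required of all subsets because it is used again on what
    remains. *)
Lemma exists_independent (m : nat) (A : {set T}) :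
  symmetric Q ->
  (forall A' : {set T}, A' \subset A -> degree_sum A' <= d * #|A'|) ->
  m * d.+1 <= #|A| ->
  exists2 J : {set T}, J \subset A &
    #|J| = m /\ {in J &, forall a b, a != b -> ~~ Q a b}.
Proof.
move=> Q_sym; elim: m A => [|m IH] A sparse szA.
  by exists set0; rewrite ?sub0set ?cards0 //; split=> // a b; rewrite inE.
have A0 : A != set0 by rewrite -card_gt0; lia.
have [a aA dega] := exists_low_degree A0 (sparse A (subxx _)).
pose N := [set b in A | (b != a) && Q a b].
have sub1 : A :\: (a |: N) \subset A by apply: subsetDl.
have szN : #|a |: N| <= d.+1.
  by rewrite cardsU1; case: (a \notin N); rewrite /= ?add1n ?ltnS // ltnW.
have szA1 : m * d.+1 <= #|A :\: (a |: N)|.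
  move: (cardsID (a |: N) A) (subset_leq_card (subsetIr A (a |: N))); lia.
have [J sJ [szJ indJ]] := IH _ (fun A' s => sparse A' (subset_trans s sub1)) szA1.
have aJ : a \notin J.
  by apply/negP => /(subsetP sJ); rewrite !inE eqxx.
have nQ b : b \in J -> a != b -> ~~ Q a b.
  move=> bJ ab; move: (subsetP sJ _ bJ); rewrite !inE eq_sym (negbTE ab) /=.
  by case/andP => + bA; rewrite bA.
exists (a |: J); first by rewrite subUset sub1set aA (subset_trans sJ).
split; first by rewrite cardsU1 aJ szJ.
move=> x y; rewrite !inE => /orP[/eqP->|xJ] /orP[/eqP->|yJ].
- by rewrite eqxx.
- exact: nQ.
- by rewrite eq_sym Q_sym; apply: nQ.
- exact: indJ.
Qed.

End AverageDegree.

Lemma degree_sum_mono (T : finType) (Q Q' : rel T) (A : {set T}) :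
  {in A &, forall a b, a != b -> Q a b -> Q' a b} ->
  degree_sum Q A <= degree_sum Q' A.
Proof.
move=> QQ; apply: leq_sum => a aA; apply: subset_leq_card.
apply/subsetP => b; rewrite !inE => /and3P[bA ba Qab]; rewrite bA ba /=.
by apply: QQ => //; rewrite eq_sym.
Qed.

Lemma degree_sum_cover (T : finType) (Q : rel T) (n : nat) (Q' : 'I_n -> rel T)
    (A : {set T}) :
  {in A &, forall a b, a != b -> Q a b -> exists p, Q' p a b} ->
  degree_sum Q A <= \sum_(p < n) degree_sum (Q' p) A.
Proof.
move=> QQ; rewrite /degree_sum exchange_big /=; apply: leq_sum => a aA.
apply: leq_trans (card_bigcup_le _); apply: subset_leq_card.
apply/subsetP => b; rewrite inE => /and3P[bA ba Qab].
have [|p Qp] := QQ a b aA bA _ Qab; first by rewrite eq_sym.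
by apply/bigcupP; exists p; rewrite ?inE ?bA ?ba.
Qed.

(** [bad l t k] is what position [k] must avoid once [t] was picked at position [l]. At most [n]
    earlier picks spoil at most [c * n] elements of [J], so a choice is always left. *)
Lemma greedy_choice (T : finType) (bad : nat -> T -> nat -> {set T}) (c n : nat)
    (J : {set T}) :
  (forall l t k, k < n -> #|J :&: bad l t k| <= c) -> c * n < #|J| ->
  exists g : nat -> T, forall k, k < n -> g k \in J /\
    forall l, l < k -> g k \notin bad l (g l) k.
Proof.
elim: n => [|n IH] few szJ.
  have /card_gt0P[t0 _] : 0 < #|J| by lia.
  by exists (fun=> t0).
have [l t k kn||g gP] := IH; [by apply: few; apply: leqW | by lia |].
pose X := J :&: \bigcup_(l < n) bad l (g l) n.
have szX : #|X| <= c * n.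
  rewrite /X big_distrr /= mulnC.
  apply: leq_trans (card_bigcup_le _) _.
  rewrite -[X in X * c](card_ord n) -sum_nat_const.
  by apply: leq_sum => l _; apply: few.
have /card_gt0P[t] : 0 < #|J :\: X|.
  move: (cardsID X J) (subset_leq_card (subsetIr J X)); lia.
rewrite !inE => /andP[+ tJ]; rewrite tJ /= => tbad.
exists (fun k => if k == n then t else g k) => k.
rewrite ltnS leq_eqVlt => /orP[/eqP->|kn]; last first.
  have [gJ gb] := gP k kn; rewrite (ltn_eqF kn); split=> // l lk.
  by rewrite (ltn_eqF (ltn_trans lk kn)); apply: gb.
rewrite eqxx; split=> // l ln; rewrite (ltn_eqF ln).
by apply: contra tbad => tb; apply/bigcupP; exists (Ordinal ln).
Qed.

(** * Bounded distances *)

Section Distance.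
Variables (V : finType) (e : rel V).
Implicit Types (x y z : V) (k l : nat).

Lemma dist_leP k x y :
  reflect (exists p, [/\ path e x p, last x p = y & size p <= k])
          (dist_le e k x y).
Proof.
apply: (iffP existsP) => [[m /existsP[p /andP[pth /eqP lst]]]|[p [pth lst sz]]].
  by exists p; split=> //; rewrite size_tuple -ltnS.
exists (Ordinal (sz : size p < k.+1)); apply/existsP; exists (in_tuple p).
by rewrite pth lst eqxx.
Qed.

Lemma dist_le_refl k x : dist_le e k x x.
Proof. by apply/dist_leP; exists [::]. Qed.

Lemma dist_le_trans k l y x z :
  dist_le e k x y -> dist_le e l y z -> dist_le e (k + l) x z.
Proof.
move=> /dist_leP[p [pp lp sp]] /dist_leP[q [pq lq sq]]; apply/dist_leP.
by exists (p ++ q); rewrite cat_path last_cat lp pp pq lq size_cat leq_add.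
Qed.

Lemma dist_le_widen k l x y : k <= l -> dist_le e k x y -> dist_le e l x y.
Proof.
move=> kl /dist_leP[p [pp lp sp]]; apply/dist_leP.
by exists p; rewrite (leq_trans sp).
Qed.

Lemma dist_le_split k l x z :
  dist_le e (k + l) x z -> exists2 y, dist_le e k x y & dist_le e l y z.
Proof.
move=> /dist_leP[p [pp lp sp]]; exists (last x (take k p)); apply/dist_leP.
  exists (take k p); split=> //; first exact: take_path.
  by rewrite size_take; case: ltnP => // /leq_trans; apply.
exists (drop k p); split.
- by move: pp; rewrite -{1}(cat_take_drop k p) cat_path => /andP[].
- by rewrite -last_cat cat_take_drop.
- by rewrite size_drop; lia.
Qed.

Lemma dist_le1 x y : dist_le e 1 x y -> x = y \/ e x y.
Proof.
move=> /dist_leP[[|z [|? ?]] [//= pp lp sz]]; first by left.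
by right; rewrite -lp; move: pp; rewrite andbT.
Qed.

Lemma dist_le_symmetric k : symmetric e -> symmetric (dist_le e k).
Proof.
move=> es; suff sub x y : dist_le e k x y -> dist_le e k y x.
  by move=> x y; apply/idP/idP; apply: sub.
elim: k x y => [|k IH] x y.
  by move=> /dist_leP[[|? ?] [//= _ -> _]]; apply: dist_le_refl.
rewrite -addn1 => /dist_le_split[z /IH xz /dist_le1[<-|zy]].
  by apply: dist_le_widen xz; rewrite leq_addr.
rewrite addnC; apply: dist_le_trans xz; apply/dist_leP; exists [:: z].
by rewrite /= es zy.
Qed.

End Distance.

Lemma sub_dist_le (V : finType) (e e' : rel V) (k : nat) :
  subrel e e' -> subrel (dist_le e k) (dist_le e' k).
Proof.
move=> ee x y /dist_leP[p [pp lp sp]]; apply/dist_leP.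
by exists p; rewrite (sub_path ee).
Qed.

(** * Sparsity of shallow minors *)

Definition sparse_minors (G : sgraph) (t f : nat) : Prop :=
  forall M, shallow_minor t M G -> #|edges M| <= f * #|M|.

Definition touch (G : sgraph) : rel {set G} :=
  fun X Y => [exists x in X, exists y in Y, adj x y].

Lemma touchP (G : sgraph) (X Y : {set G}) :
  reflect (exists x y, [/\ x \in X, y \in Y & adj x y]) (touch X Y).
Proof.
apply: (iffP exists_inP) => [[x xX /exists_inP[y yY xy]]|[x [y [xX yY xy]]]].
  by exists x, y.
by exists x => //; apply/exists_inP; exists y.
Qed.

Lemma touch_sym (G : sgraph) : symmetric (@touch G).
Proof.
suff sub (X Y : {set G}) : touch X Y -> touch Y X.
  by move=> X Y; apply/idP/idP; apply: sub.
case/touchP=> x [y [xX yY xy]]; apply/touchP; exists y, x.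
by rewrite adj_sym.
Qed.

Lemma sum_degrees_le (M : sgraph) :
  \sum_(u : M) #|[set v | adj u v]| <= 2 * #|edges M|.
Proof.
pose D := [set p : M * M | adj p.1 p.2].
have -> : \sum_(u : M) #|[set v | adj u v]| = #|D|.
  rewrite -sum1_card (eq_bigl (fun p => xpredT p.1 && adj p.1 p.2)); last first.
    by move=> p; rewrite inE.
  rewrite -(pair_big_dep xpredT (fun u v => adj u v) (fun _ _ => 1)) /=.
  by apply: eq_bigr => u _; rewrite -sum1_card; apply: eq_bigl => v; rewrite inE.
(* Only the two orderings of its ends give the edge [E]. *)
rewrite mulnC; apply: card_fiber_bound => E.
have [->|[[a b]]] := set_0Vmem [set p in D | [set p.1; p.2] == E].
  by rewrite cards0.
rewrite !inE /= => /andP[ab /eqP<-].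
apply: (@leq_trans #|[set (a, b); (b, a)]|); last by rewrite cards2; case: eqP.
apply: subset_leq_card; apply/subsetP => -[x y]; rewrite !inE /=.
case/andP=> xy /eqP/setP eqE; rewrite !xpair_eqE.
have xy' : x != y by apply: contraTneq xy => ->; rewrite adj_irrefl.
move: (eqE x) (eqE y) xy'; rewrite !inE !eqxx orbT /= => + /esym.
have [->|_] := eqVneq x a; have [->|_] := eqVneq y b; rewrite //= ?orbF ?orbT //.
- by move=> _ /eqP->; rewrite eqxx.
- by move=> /esym/eqP->; rewrite eqxx.
- by move=> /esym-> ->.
Qed.

(** Contracting every [B a] gives a minor on [X] whose edges are the touching pairs; the degree sum
    counts each of them twice. *)
Lemma degree_sum_touch (G : sgraph) (t f : nat) (X : {set G}) (B : G -> {set G}) :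
  sparse_minors G t f ->
  {in X, forall a, connected_radius_le t (B a)} ->
  {in X &, forall a b, a != b -> [disjoint B a & B b]} ->
  degree_sum (fun a b => touch (B a) (B b)) X <= 2 * f * #|X|.
Proof.
move=> sp rad dis.
pose V : finType := {a in X}.
pose e : rel V := [rel u v | (v != u) && touch (B (val u)) (B (val v))].
have es : symmetric e by move=> u v; rewrite /e /= eq_sym touch_sym.
have ei : irreflexive e by move=> u; rewrite /e /= eqxx.
pose M := SGraph es ei.
have minM : shallow_minor t M G.
  exists (fun u : M => B (val u)); split=> [u|u v uv|u v uv].
  - exact: rad (valP u).
  - exact: dis (valP u) (valP v) uv.
  - have -> : @adj M u v = touch (B (val u)) (B (val v)).
      by rewrite /= /e /= eq_sym uv.
    by split; [move/touchP | move=> h; apply/touchP].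
have := leq_trans (sum_degrees_le M) (leq_mul (leqnn 2) (sp M minM)).
rewrite mulnA card_sig; apply: leq_trans.
rewrite /degree_sum big_sub /=; apply: leq_sum => u _.
rewrite -(card_imset _ val_inj); apply: subset_leq_card; apply/subsetP => b.
rewrite inE => /andP[bX bu]; apply/imsetP.
by exists (Sub b bX : V); rewrite ?inE.
Qed.

(** * Scattered sets *)

Section Scattered.
Variable G : sgraph.
Implicit Types (S A J W : {set G}) (a b w : G).

(* The vertices of [S] become isolated instead of being deleted. *)
Definition avoid S : rel G :=
  [rel x y | [&& x \notin S, y \notin S & adj x y]].

Definition ball S k a : {set G} := [set v | dist_le (avoid S) k a v].

Definition scattered S k A : Prop :=
  {in A &, forall a b, a != b -> ~~ dist_le (avoid S) k a b}.

Lemma avoid_adj S a b : avoid S a b -> adj a b.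
Proof. by case/and3P. Qed.

Lemma avoid_sym S : symmetric (avoid S).
Proof. by move=> a b; rewrite /avoid /= adj_sym andbCA. Qed.

Lemma avoid_sub S S' : S \subset S' -> subrel (avoid S') (avoid S).
Proof.
move=> sub a b /and3P[aS bS ab].
by apply/and3P; split=> //; apply: contra (subsetP sub _) _.
Qed.

Lemma dist_avoid_sym S k : symmetric (dist_le (avoid S) k).
Proof. exact/dist_le_symmetric/avoid_sym. Qed.

Lemma scattered_sub S S' k A A' :
  S \subset S' -> A' \subset A -> scattered S k A -> scattered S' k A'.
Proof.
move=> sS sA sc a b aA bA ab; have := sc a b (subsetP sA _ aA) (subsetP sA _ bA) ab.
by apply: contra; apply: sub_dist_le; apply: avoid_sub.
Qed.

(** The last edge of a nonempty walk cannot end in [S]. *)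
Lemma dist_avoid_in S k a w : w \in S -> dist_le (avoid S) k a w -> a = w.
Proof.
move=> wS /dist_leP[p [pp lp _]]; case/lastP: p pp lp => // p x.
by rewrite rcons_path last_rcons => /andP[_ /and3P[_ + _]] xw; rewrite xw wS.
Qed.

Lemma walks_radius (t : nat) (B : {set G}) (c : G) :
  c \in B ->
  {in B, forall v, exists p,
     [/\ path (@adj G) c p, last c p = v, size p <= t & {subset p <= B}]} ->
  connected_radius_le t B.
Proof.
move=> cB walk; exists c => // v /walk[p [pp lp sp pB]].
apply/dist_leP; exists p; split=> //; clear lp sp walk.
elim: p c cB pp pB => //= x p IH c cB /andP[cx pp] pB.
have xB : x \in B by apply: pB; rewrite mem_head.
rewrite /induced_adj /= cB xB cx /=; apply: IH => // y yp.
by apply: pB; rewrite inE yp orbT.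
Qed.

Lemma center_in_ball S k a : a \in ball S k a.
Proof. by rewrite inE dist_le_refl. Qed.

(** A prefix of a short walk from [a] is again a short walk from [a], so the walk never leaves the
    ball. *)
Lemma ball_walk S k a v : v \in ball S k a ->
  exists p, [/\ path (@adj G) a p, last a p = v, size p <= k
               & {subset p <= ball S k a}].
Proof.
rewrite inE => /dist_leP[p [pp lp sp]]; exists p; split=> //.
  by apply: sub_path pp => x y; apply: avoid_adj.
move=> x xp; case/splitPr: xp pp lp sp => p1 p2.
rewrite cat_path size_cat /= => /and3P[pp1 ex _] _ sp.
rewrite inE; apply/dist_leP; exists (rcons p1 x).
by rewrite rcons_path pp1 ex last_rcons size_rcons; split=> //; lia.
Qed.

Lemma ball_radius S k a : connected_radius_le k (ball S k a).
Proof. by apply: (walks_radius (center_in_ball S k a)) => v /ball_walk. Qed.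

Lemma ballS_neighbor S k a w : w \in ball S k.+1 a -> w \notin ball S k a ->
  exists2 u, u \in ball S k a & adj u w.
Proof.
rewrite inE -addn1 => /dist_le_split[u au /dist_le1[<-|/avoid_adj uw]].
  by rewrite inE au.
by exists u; rewrite ?inE.
Qed.

Lemma ball_disjoint S i j A a b : scattered S (i + j) A ->
  a \in A -> b \in A -> a != b -> [disjoint ball S i a & ball S j b].
Proof.
move=> sc aA bA ab; apply/pred0P => v; apply/negP => /andP[/=].
rewrite !inE => av bv; move: (sc a b aA bA ab) => /negP; apply.
by apply: dist_le_trans av _; rewrite dist_avoid_sym.
Qed.

(** The balls of radius [i] are disjoint, and centres at distance at most [2i + 1] have touching
    balls, so an independent set in a sparse minor of depth [i] is wanted. *)
Lemma scatter_odd S i f m A :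
  sparse_minors G i f -> scattered S (i + i) A -> m * (2 * f).+1 <= #|A| ->
  exists2 J : {set G}, J \subset A & #|J| = m /\ scattered S (i + i).+1 J.
Proof.
move=> sp sc; apply: exists_independent; first exact: dist_avoid_sym.
move=> A' /subsetP sA; pose B := ball S i.
have dis : {in A' &, forall a b, a != b -> [disjoint B a & B b]}.
  by move=> a b aA bA; apply: ball_disjoint sc _ _; apply: sA.
apply: leq_trans (degree_sum_touch sp _ dis); last first.
  by move=> a _; apply: ball_radius.
apply: degree_sum_mono => a b aA bA ab.
rewrite -addSn => /dist_le_split[v av vb]; apply/touchP.
have vB : v \in B b by rewrite inE dist_avoid_sym.
have va : v \in ball S i.+1 a by rewrite inE.
have [u ua uv] := ballS_neighbor va (negbT (disjointFl (dis a b aA bA ab) vB)).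
by exists u, v.
Qed.

Definition reaching S i A w : {set G} := [set a in A | w \in ball S i.+1 a].

(* For every [p], contracting each [w] into the [p]-th ball reaching it gives a
   sparse minor; together these minors see every pair of balls reaching a
   common vertex. *)
Lemma scatter_even S i f m D A :
  sparse_minors G i.+1 f -> scattered S (i + i).+1 A ->
  (forall w, #|reaching S i A w| <= D) -> m * (D * (2 * f)).+1 <= #|A| ->
  exists2 J : {set G}, J \subset A & #|J| = m /\ scattered S (i.+1 + i.+1) J.
Proof.
move=> sp sc few; apply: exists_independent; first exact: dist_avoid_sym.
move=> A' sA; have sc' := scattered_sub (subxx S) sA sc.
pose B (p : nat) a := ball S i a :|:
  [set w in ball S i.+1 a | index a (enum (reaching S i A w)) == p].
have reach a w : a \in A' -> w \in ball S i.+1 a -> a \in enum (reaching S i A w).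
  by move=> aA aw; rewrite mem_enum !inE (subsetP sA) //; move: aw; rewrite inE.
have disj1 a b : a \in A' -> b \in A' -> a != b ->
    [disjoint ball S i.+1 a & ball S i b].
  by apply: ball_disjoint; rewrite addSn.
have dis p : {in A' &, forall a b, a != b -> [disjoint B p a & B p b]}.
  move=> a b aA bA ab; apply/pred0P => w; apply/negP => /andP[/=].
  have ba : b != a by rewrite eq_sym.
  have sub c : w \in ball S i c -> w \in ball S i.+1 c.
    by rewrite !inE; apply: dist_le_widen.
  case/setUP=> [aw|]; first case/setUP=> [bw|].
  - by rewrite (disjointFr (disj1 a b aA bA ab) (sub _ aw)) in bw.
  - rewrite inE => /andP[bw _].
    by rewrite (disjointFr (disj1 b a bA aA ba) bw) in aw.
  rewrite inE => /andP[aw /eqP ip] /setUP[bw|].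
    by rewrite (disjointFr (disj1 a b aA bA ab) aw) in bw.
  rewrite inE -ip => /andP[bw /eqP].
  (* Both [a] and [b] are the [p]-th centre reaching [w], hence equal. *)
  move/(index_inj a (reach _ _ bA bw) (reach _ _ aA aw)) => eqba.
  by rewrite eqba eqxx in ab.
have rad p : {in A', forall a, connected_radius_le i.+1 (B p a)}.
  move=> a _; apply: (@walks_radius _ _ a); first by rewrite !inE dist_le_refl.
  have sub : {subset ball S i a <= B p a} by move=> x xa; rewrite inE xa.
  move=> w; have [aw _|aw] := boolP (w \in ball S i a).
    have [q [pq lq sq qB]] := ball_walk aw; exists q; split=> //.
      exact: leq_trans sq _.
    by move=> x /qB/sub.
  move=> wB; have: w \in ball S i.+1 a.
    by move: wB; rewrite inE (negbTE aw) inE => /andP[].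
  (* A vertex outside the smaller ball hangs on it by one edge, whence radius [i.+1]. *)
  case/ballS_neighbor=> // u /ball_walk[q [pq lq sq qB]] uw.
  exists (rcons q w); rewrite rcons_path pq lq uw last_rcons size_rcons.
  split=> // x; rewrite mem_rcons inE => /predU1P[->//|/qB/sub//].
apply: (@leq_trans (\sum_(p < D) degree_sum (fun a b => touch (B p a) (B p b)) A')).
  (* The midpoint [w] of the walk is reached by both balls. With [p] the index of [a] at [w], the
     set [B p a] contains [w], which has a neighbour in the smaller ball of [b]. *)
  apply: degree_sum_cover => a b aA bA ab /dist_le_split[w aw wb].
  have wa : w \in ball S i.+1 a by rewrite inE.
  have wb' : w \in ball S i.+1 b by rewrite inE dist_avoid_sym.
  have ltD : index a (enum (reaching S i A w)) < D.
    by apply: leq_trans (few w); rewrite cardE index_mem reach.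
  exists (Ordinal ltD); apply/touchP => /=.
  have [|u ub uw] := ballS_neighbor wb'.
    by rewrite (disjointFr (disj1 a b aA bA ab) wa).
  by exists w, u; rewrite adj_sym uw !in_setU ub inE wa eqxx orbT.
apply: (@leq_trans (\sum_(p < D) 2 * f * #|A'|)).
  by apply: leq_sum => p _; apply: (degree_sum_touch (B := B p) sp).
by rewrite sum_nat_const card_ord mulnA.
Qed.

(* [W] and the balls around [A] are the two sides of a biclique minor. *)
Lemma biclique_bound S i f A W :
  sparse_minors G i f -> scattered S (i + i).+1 A -> 2 <= #|A| ->
  #|W| <= #|A| -> {in A & W, forall a w, w \in ball S i.+1 a} ->
  #|W| <= 4 * f.
Proof.
move=> sp sc A2 WA full.
(* A second centre exists; its larger ball contains [w] and misses the smaller ball of [a]. *)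
have notin a w : a \in A -> w \in W -> w \notin ball S i a.
  move=> aA wW; have /card_gt0P[b] : 0 < #|A :\ a|.
    by move: (cardsD1 a A); rewrite aA; lia.
  rewrite !inE => /andP[ba bA]; rewrite -addSn in sc.
  move: (ball_disjoint sc bA aA ba) => /disjointFr/(_ (full b w bA wW)).
  by rewrite inE => ->.
have disAW : [disjoint A & W].
  apply/pred0P => a; apply/negP => /andP[/= aA aW].
  by move: (notin a a aA aW); rewrite center_in_ball.
pose B x := if x \in A then ball S i x else [set x].
have rad : {in A :|: W, forall x, connected_radius_le i (B x)}.
  move=> x _; rewrite /B; case: ifP => _; first exact: ball_radius.
  apply: (@walks_radius _ _ x); first by rewrite inE.
  by move=> y /set1P->; exists [::].
have dis : {in A :|: W &, forall x y, x != y -> [disjoint B x & B y]}.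
  have sc0 : scattered S (i + i) A.
    by move=> a b aA bA ab; apply: contra (sc a b aA bA ab); apply: dist_le_widen.
  have aux a w : a \in A -> w \in W -> [disjoint ball S i a & [set w]].
    by move=> aA wW; rewrite disjoint_sym disjoints1 notin.
  move=> x y; rewrite /B !in_setU.
  case: ifP => [xA _|xA /= xW]; case: ifP => [yA _|yA /= yW] xy.
  - exact: ball_disjoint sc0 _ _ xy.
  - exact: aux.
  - by rewrite disjoint_sym aux.
  - by rewrite disjoints1 inE.
have := degree_sum_touch sp rad dis.
have lo : #|A| * #|W| <= degree_sum (fun x y => touch (B x) (B y)) (A :|: W).
  rewrite /degree_sum -sum_nat_const [X in _ <= X](big_setID A) /= setUK.
  apply: leq_trans (leq_addr _ _); apply: leq_sum => a aA.
  apply: subset_leq_card; apply/subsetP => w wW.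
  have wA : w \in A = false by rewrite (disjointFl disAW).
  rewrite !inE wW orbT /=; apply/andP; split.
    by apply: contraTneq aA => <-; rewrite wA.
  have [u uB uw] := ballS_neighbor (full a w aA wW) (notin a w aA wW).
  by apply/touchP; exists u, w; rewrite /B aA wA inE eqxx.
(* As [W] is no larger than [A], the two estimates give [#|A| * #|W| <= 2 * f * (2 * #|A|)], whence
   the constant [4 * f]. *)
have : #|A :|: W| <= 2 * #|A| by rewrite cardsU; lia.
move=> hAW hi; rewrite leqNgt; apply/negP => hW.
have : #|A| * (4 * f).+1 <= 4 * f * #|A| by nia.
nia.
Qed.

(** The number of centres needed while [k] more vertices may be removed. [K.+2] meets the size
    conditions of [biclique_bound]; the product is what [scatter_even] asks for when no vertex is
    reached by more than [threshold K d m k'] balls. *)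
Fixpoint threshold (K d m k : nat) : nat :=
  K.+2 + if k is k'.+1 then m * (threshold K d m k' * d).+1 else 0.

(** Induction on [k], where [W] holds the vertices removed so far, each reached by all of [A]. A
    vertex reached by many balls joins [W] and [A] shrinks to the centres reaching it; if there is
    none, [scatter_even] concludes. For [k = 0] the size of [W] contradicts [biclique_bound]. *)
Lemma scatter_remove S i f f' m k A W :
  sparse_minors G i f -> sparse_minors G i.+1 f' ->
  scattered S (i + i).+1 A ->
  {in A & W, forall a w, w \in ball S i.+1 a} ->
  #|W| + k = (4 * f).+1 ->
  threshold (4 * f).+1 (2 * f') m k <= #|A| ->
  exists W' J, [/\ #|W'| <= (4 * f).+1, J \subset A, #|J| = m
                 & scattered (S :|: W') (i.+1 + i.+1) J].
Proof.
move=> sp sp'; elim: k A W => [|k IH] A W sc full szW;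
  set K := (4 * f).+1 in szW * => szA.
  suff : #|W| <= 4 * f by lia.
  move: szA; rewrite /= => szA.
  by apply: biclique_bound sp sc _ _ full; lia.
pose D := threshold K (2 * f') m k.
have scW := scattered_sub (subsetUl S W) (subxx A) sc.
have [/forallP few|] := boolP [forall w, #|reaching (S :|: W) i A w| <= D].
  have [|J sJ [szJ scJ]] := scatter_even (m := m) sp' scW few.
    by apply: leq_trans szA; rewrite /= leq_addl.
  by exists W, J; split=> //; lia.
rewrite negb_forall => /existsP[w]; rewrite -ltnNge => many.
have D2 : 2 <= D by rewrite /D; case: (k) => /=; lia.
(* Removed vertices are isolated, so only a ball centred at [w] could reach such a [w], while more
   than [D] balls do. *)
have wW : w \notin W.
  apply/negP => wW; move: many; rewrite ltnNge => /negP; apply.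
  apply: (@leq_trans #|[set w]|); last by rewrite cards1; lia.
  apply: subset_leq_card; apply/subsetP => a; rewrite !inE => /andP[_ aw].
  by apply/eqP; apply: dist_avoid_in aw; rewrite inE wW orbT.
have sub : reaching (S :|: W) i A w \subset A.
  by apply/subsetP => a; rewrite inE => /andP[].
have [] := IH (reaching (S :|: W) i A w) (w |: W).
- exact: scattered_sub (subxx S) sub sc.
- move=> a v aR /setU1P[->|vW]; last by apply: full => //; apply: (subsetP sub).
  move: aR; rewrite !inE => /andP[_]; apply: sub_dist_le; exact/avoid_sub/subsetUl.
- by rewrite cardsU1 wW; lia.
- exact: ltnW.
move=> W' [J [szW' sJ szJ scJ]]; exists W', J; split=> //.
exact: subset_trans sub.
Qed.

End Scattered.

(** An odd and an even step raise the distance from [i + i] to [i.+1 + i.+1]. The number of removals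
    per round is independent of [m], so [c] can be fixed before [m]. *)
Lemma bounded_expansion_wide (C : graph_class) (i : nat) :
  bounded_expansion C ->
  exists c, forall m, exists N, forall (G : sgraph) (A : {set G}), C G -> N <= #|A| ->
    exists S J : {set G},
      [/\ #|S| <= c, J \subset A, m <= #|J| & scattered S (i + i) J].
Proof.
case=> f fP; have sp t G : C G -> sparse_minors G t (f t).
  by move=> CG M; apply: fP.
elim: i => [|i [c IH]].
  exists 0 => m; exists m => G A _ szA.
  exists set0, A; rewrite cards0; split=> // a b _ _ ab.
  by apply: contra ab => /dist_leP[[|? ?] [//= _ -> _]].
exists (c + (4 * f i).+1) => m.
(* Sizes are computed backwards: [N1] centres serve the removal step started with empty [W], and
   [(2 * f i).+1] times as many serve the odd step before it. *)
pose N1 := threshold (4 * f i).+1 (2 * f i.+1) m (4 * f i).+1.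
have [N NP] := IH (N1 * (2 * f i).+1); exists N => G A CG szA.
have [S [J0 [szS sJ0 szJ0 sc0]]] := NP G A CG szA.
have [|J1 sJ1 [szJ1 sc1]] := scatter_odd (m := N1) (sp i G CG) sc0.
  exact: szJ0.
have [|||W [J [szW sJ szJ sc]]] :=
  scatter_remove (k := (4 * f i).+1) (m := m) (W := set0)
    (sp i G CG) (sp i.+1 G CG) sc1.
- by move=> a w _; rewrite inE.
- by rewrite cards0.
- by rewrite szJ1.
exists (S :|: W), J; split=> //.
- by rewrite cardsU (leq_trans (leq_subr _ _)) // leq_add.
- exact: subset_trans sJ (subset_trans sJ1 sJ0).
- by rewrite szJ.
Qed.

(** * Families of sequences *)

(** Indices replace vertices because a sequence may repeat values. Values in [S] are exempt, so a
    value repeated too often is dealt with by putting it into [S]. *)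
Definition separated (G : sgraph) (I : finType) (S : {set G}) (k : nat)
    (a : I -> G) (J : {set I}) : Prop :=
  {in J &, forall x y, x != y ->
     a x \notin S -> ~~ dist_le (avoid S) k (a x) (a y)}.

Lemma separated_sub (G : sgraph) (I : finType) (S S' : {set G}) (k : nat)
    (a : I -> G) (J J' : {set I}) :
  S \subset S' -> J' \subset J -> separated S k a J -> separated S' k a J'.
Proof.
move=> sS sJ sep x y xJ yJ xy aS'.
have aS : a x \notin S by apply: contra aS'; apply: subsetP.
have := sep x y (subsetP sJ _ xJ) (subsetP sJ _ yJ) xy aS.
by apply: contra; apply: sub_dist_le; apply: avoid_sub.
Qed.

Lemma bounded_expansion_sequence (C : graph_class) (i : nat) :
  bounded_expansion C ->
  exists c, forall m, exists N, forall (G : sgraph) (I : finType) (a : I -> G)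
    (A : {set I}), C G -> N <= #|A| ->
    exists (S : {set G}) (J : {set I}),
      [/\ #|S| <= c, J \subset A, m <= #|J| & separated S (i + i) a J].
Proof.
move=> /(bounded_expansion_wide i)[c cP]; exists c.+1 => m.
have [N NP] := cP m; exists (N * m.+1) => G I a A CG szA.
(* A value taken at least [m] times forms [S] alone, and its indices are vacuously separated. *)
have [/existsP[v many]|few] := boolP [exists v, m <= #|[set x in A | a x == v]|].
  exists [set v], [set x in A | a x == v]; split=> //; first by rewrite cards1.
    by apply/subsetP => x; rewrite inE => /andP[].
  by move=> x y; rewrite !inE => /andP[_ /eqP->] _ _; rewrite eqxx.
(* Otherwise equality of values has degrees below [m], so [N] indices with distinct values can be
   kept and the result for vertex sets applies. *)
have [|A' sA|J0 sJ0 [szJ0 inj]] :=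
    @exists_independent I (fun x y => a x == a y) m N A _ _ szA.
- by move=> x y; rewrite eq_sym.
- rewrite mulnC -sum_nat_const; apply: leq_sum => x _.
  move: few; rewrite negb_exists => /forallP/(_ (a x)).
  rewrite -ltnNge => /ltnW; apply: leq_trans; apply: subset_leq_card.
  apply/subsetP => y; rewrite !inE => /and3P[yA _ axy].
  by rewrite (subsetP sA) // eq_sym.
have injJ0 : {in J0 &, injective a}.
  by move=> x y xJ yJ /eqP; apply: contraTeq; apply: inj.
have [|S [J [szS sJ szJ sc]]] := NP G (a @: J0) CG.
  by rewrite card_in_imset // szJ0.
have sJ' : [set x in J0 | a x \in J] \subset J0.
  by apply/subsetP => x; rewrite inE => /andP[].
exists S, [set x in J0 | a x \in J]; split.
- exact: leqW.
- exact: subset_trans sJ' sJ0.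
- apply: leq_trans szJ _; apply: leq_trans (leq_imset_card a _).
  apply: subset_leq_card; apply/subsetP => v vJ.
  have /imsetP[x xJ0 vx] := subsetP sJ v vJ.
  by apply/imsetP; exists x => //; rewrite inE xJ0 -vx.
- move=> x y; rewrite !inE => /andP[xJ0 axJ] /andP[yJ0 ayJ] xy _.
  by apply: sc => //; apply: contra xy => /eqP/injJ0->.
Qed.

(** The sequences are treated one after another on the surviving indices; enlarging [S] and
    shrinking [J] preserve the earlier separations. *)
Lemma bounded_expansion_sequences (C : graph_class) (i n : nat) :
  bounded_expansion C ->
  exists c, forall m, exists N, forall (G : sgraph) (I : finType)
    (a : nat -> I -> G) (A : {set I}), C G -> N <= #|A| ->
    exists (S : {set G}) (J : {set I}),
      [/\ #|S| <= c, J \subset A, m <= #|J|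
        & forall k, k < n -> separated S (i + i) (a k) J].
Proof.
move=> hC; have [c1 c1P] := bounded_expansion_sequence i hC.
elim: n => [|n [c cP]].
  exists 0 => m; exists m => G I a A _ szA.
  by exists set0, A; rewrite cards0; split.
exists (c + c1) => m; have [N1 N1P] := c1P m; have [N NP] := cP N1.
exists N => G I a A CG szA.
have [S [J [szS sJ szJ sep]]] := NP G I a A CG szA.
have [S1 [J1 [szS1 sJ1 szJ1 sep1]]] := N1P G I (a n) J CG szJ.
exists (S :|: S1), J1; split=> //.
- by rewrite cardsU (leq_trans (leq_subr _ _)) // leq_add.
- exact: subset_trans sJ1 sJ.
move=> k; rewrite ltnS leq_eqVlt => /orP[/eqP->|kn].
  exact: separated_sub (subsetUr _ _) (subxx _) sep1.
exact: separated_sub (subsetUl _ _) sJ1 (sep k kn).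
Qed.

(** * Rainbow sets in powers *)

Lemma dist_le_through (G : sgraph) (S : {set G}) (r : nat) (u v : G) :
  dist_le (@adj G) r u v ->
  v \notin S /\ dist_le (avoid S) r u v \/
  exists s q, [/\ s \in S, q <= r, dist_le (@adj G) (r - q) u s
                & dist_le (@adj G) q s v].
Proof.
move=> /dist_leP[p [pp lp sp]].
have [/allP out|] := boolP (all [predC S] (u :: p)).
  left; split; first by rewrite -lp; apply: out; rewrite mem_last.
  apply/dist_leP; exists p; split=> //.
  apply: (@sub_in_path _ [predC S] (@adj G)) pp; last exact/allP.
  by move=> x y xS yS xy; apply/and3P.
(* The walk is cut at a vertex [s] of [S]; [q] is the length of the part after [s]. *)
rewrite -has_predC => /hasP[s sp' /negPn sS]; right.
case/splitPl: sp' pp lp sp => p1 p2 lp1.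
rewrite cat_path last_cat size_cat lp1 => /andP[pp1 pp2] lp sp.
have p2r : size p2 <= r := leq_trans (leq_addl _ _) sp.
exists s, (size p2); split=> //.
  by apply/dist_leP; exists p1; split=> //; rewrite leq_subRL // addnC.
by apply/dist_leP; exists p2.
Qed.

Lemma power_families_have_rainbow (C : graph_class) (r n : nat) :
  bounded_expansion C -> 0 < n ->
  exists N, forall G : sgraph, C G -> families_have_rainbow (power G r) n N.
Proof.
move=> hC n0; have [c cP] := bounded_expansion_sequences r n hC.
(* [P] bounds the number of profiles: a subset of [S], where [#|S| <= c], for each of the [n]
   positions and each of the [r.+1] distances. *)
pose P := (2 ^ c) ^ (n * r.+1).
(* This leaves more than [2 * n] indices of equal profile for the greedy choice; [N.+1] makes the
   index type inhabited. *)
have [N NP] := cP (P * (2 * n)).+1; exists N.+1 => G CG F FP.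
have szF t : #|F t| = n by case: (FP t).
have /card_gt0P[x0 _] : 0 < #|F ord0| by rewrite szF.
pose a k (t : 'I_N.+1) : G := nth x0 (enum (F t)) k.
have aF k t : k < n -> a k t \in F t.
  by move=> kn; rewrite -mem_enum mem_nth // -cardE szF.
have a_far t k l : k < n -> l < n -> k != l ->
    ~~ dist_le (@adj G) r (a k t) (a l t).
  move=> kn ln kl; have /(_ _ _ (aF k t kn) (aF l t ln)) := (FP t).1.
  rewrite /= negb_and negbK => /orP[|//].
  by rewrite /a nth_uniq ?enum_uniq -?cardE ?szF // (negbTE kl).
have [|S [J0 [szS _ szJ0 sep]]] := NP G _ a setT CG.
  by rewrite cardsT card_ord.
pose prof t := [ffun kq : 'I_n * 'I_r.+1 =>
  [set s in S | dist_le (@adj G) kq.2 s (a kq.1 t)]].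
have [|pr szJ] := @exists_large_fiber _ _ prof J0 (2 * n).
  apply: leq_trans szJ0; rewrite ltnS leq_mul2r; apply/orP; right.
  apply: (@leq_trans #|ffun_on (powerset S) : pred {ffun 'I_n * 'I_r.+1 -> {set G}}|).
    apply: subset_leq_card; apply/subsetP => _ /imsetP[t _ ->].
    apply/ffun_onP => kq; rewrite ffunE powersetE.
    by apply/subsetP => s; rewrite inE => /andP[].
  rewrite card_ffun_on card_powerset card_prod !card_ord /P.
  by rewrite leq_exp2r ?muln_gt0 ?n0 // leq_exp2l.
set J := [set t in J0 | prof t == pr] in szJ.
have sJ : J \subset J0 by apply/subsetP => t; rewrite inE => /andP[].
have profJ t t' k q s : t \in J -> t' \in J -> k < n -> q <= r -> s \in S ->
    dist_le (@adj G) q s (a k t) -> dist_le (@adj G) q s (a k t').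
  rewrite !inE => /andP[_ /eqP pt] /andP[_ /eqP pt'] kn qr sS.
  have /ffunP/(_ (Ordinal kn, Ordinal (qr : q < r.+1))) : prof t = prof t'.
    by rewrite pt pt'.
  by rewrite !ffunE => /setP/(_ s); rewrite !inE sS /= => ->.
pose conflict l t k := [set t' | (a k t' \notin S) &&
  dist_le (avoid S) r (a l t) (a k t')].
(* One index is [t] itself, excluded to make [phi] injective. At most one other conflicts: two would
   have [k]-th elements within [r + r] of each other via the [l]-th element of [F t], against
   separation. *)
have few l t k : k < n -> #|J :&: (t |: conflict l t k)| <= 2.
  move=> kn; rewrite setIUr; apply: leq_trans (leq_card_setU _ _) _.
  rewrite -[2]/(1 + 1); apply: leq_add.
    by apply: leq_trans (subset_leq_card (subsetIr _ _)) _; rewrite cards1.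
  rewrite leqNgt; apply/negP => /card_gt1P[x [y [+ + xy]]].
  rewrite !in_setI => /andP[xJ] + /andP[yJ]; rewrite !inE => /andP[xS ux] /andP[_ uy].
  have := sep k kn x y (subsetP sJ _ xJ) (subsetP sJ _ yJ) xy xS.
  by move/negP; apply; apply: dist_le_trans uy; rewrite dist_avoid_sym.
have [g gP] := greedy_choice few szJ.
pose b k := a k (g k).
(* The choice of [g k] excludes walks avoiding [S]. If a walk passes through [s] in [S], equal
   profiles put [s] as near to the [k]-th element of [F (g l)], so two elements of [F (g l)] would
   be within [r]. *)
have b_far' l k : l < k -> k < n -> ~~ dist_le (@adj G) r (b l) (b k).
  move=> lk kn; have ln := ltn_trans lk kn.
  have [glJ _] := gP l ln; have [gkJ /(_ l lk)] := gP k kn.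
  rewrite !inE => nc; apply/negP => /(dist_le_through S)[[bS blk]|].
    by rewrite bS blk orbT in nc.
  case=> s [q [sS qr ls sk]]; have := a_far (g l) l k ln kn (negbT (ltn_eqF lk)).
  move/negP; apply; rewrite -(subnK qr); apply: dist_le_trans ls _.
  exact: profJ gkJ glJ kn qr sS sk.
have b_far l k : l < n -> k < n -> l != k -> ~~ dist_le (@adj G) r (b l) (b k).
  move=> ln kn; rewrite neq_ltn => /orP[lk|kl]; first exact: b_far'.
  by rewrite (dist_le_symmetric _ (@adj_sym G)) b_far'.
have b_inj : injective (fun k : 'I_n => b k).
  move=> k l eqb; apply/val_inj/eqP; apply: contraTT isT => kl.
  by have := b_far k l (ltn_ord k) (ltn_ord l) kl; rewrite eqb dist_le_refl.
have g_inj k l : k < n -> l < n -> g k = g l -> k = l.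
  move=> kn ln eqg; apply/eqP; apply: contraTT isT; rewrite neq_ltn.
  case/orP=> [kl|lk].
    by have [_ /(_ k kl)] := gP l ln; rewrite eqg !inE eqxx.
  by have [_ /(_ l lk)] := gP k kn; rewrite eqg !inE eqxx.
(* By [b_inj] the position found is unique; [g 0] is a default off the rainbow set, where [phi] is
   unconstrained. *)
pose phi v := if [pick k : 'I_n | b k == v] is Some k then g k else g 0.
have phi_b (k : 'I_n) : phi (b k) = g k.
  rewrite /phi; case: pickP => [l /eqP/b_inj->//|/(_ k)].
  by rewrite eqxx.
exists [set b k | k : 'I_n]; last by rewrite card_imset // card_ord.
split=> [_ _ /imsetP[k _ ->] /imsetP[l _ ->]|].
  rewrite /= negb_and negbK; have [->|kl] := eqVneq k l; first by rewrite eqxx.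
  by rewrite b_far ?orbT.
exists phi; split=> [_ _ /imsetP[k _ ->] /imsetP[l _ ->]|_ /imsetP[k _ ->]].
  by rewrite !phi_b => /g_inj -> //.
by rewrite phi_b aF.
Qed.

(** The rainbow number is the minimum of a predicate in [Prop], so its existence is obtained by
    excluded middle. *)
Lemma exists_least (P : nat -> Prop) (N : nat) :
  P N -> exists2 k, P k /\ (forall j, P j -> k <= j) & k <= N.
Proof.
elim/ltn_ind: N => N IH PN.
have [[j [Pj jN]]|none] := classic (exists j, P j /\ j < N).
  by have [k kP kj] := IH j jN Pj; exists k => //; apply: leq_trans kj (ltnW jN).
exists N => //; split=> // j Pj; rewrite leqNgt; apply/negP => jN.
by apply: none; exists j.
Qed.

Theorem theorem1p1 (C : graph_class) (r : nat) (hC : bounded_expansion C)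
    (hr : 0 < r) :
  rainbow_property (power_class r C) /\
  (forall n : nat, 0 < n -> exists N : nat, forall G : sgraph, C G ->
     families_have_rainbow (power G r) n N).
Proof.
have main := fun n => @power_families_have_rainbow C r n hC.
split=> // n n0; have [N NP] := main n n0; exists N => _ [G CG ->].
exact: exists_least (NP G CG).
Qed.
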